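(* Let $G=(V,E)$ be a connected undirected graph with $n$ nodes, let $0\le p\le 1$, and let each node independently be private with probability $p$ and public otherwise. Under the condition that all the public nodes belong to the largest public-cluster, we have $$\left|\,n-\frac{E_{pri}[n^*]\;E_{pri}\left[\sum_{v_i\in V^*}d_i^*d_i\right]}{E_{pri}\left[\sum_{v_i\in V^*}(d_i^* )^2\right]}\right|\le\left|\,n-E_{pri}[n^*]\right|.$$
   Context: $G=(V,E)$, $V=\{v_1,\dots,v_n\}$, is a connected undirected graph and $d_i$ is the degree of $v_i$ in $G$. $E_{pri}$ denotes expectation regarding the random set of privacy labels. The public-clusters are the connected components of the subgraph of $G$ formed by the public nodes; $C^*=(V^*,E^* )$ is the largest public-cluster and $n^*=|V^*|$. For $v_i\in V^*$, the public-degree is $d_i^*=|\{v_j\in V^*:(v_i,v_j)\in E^*\}|$. Under the condition that all the public nodes belong to the largest public-cluster, one takes $\Pr[v_i\in V^*]=\Pr[v_i\text{ is public}]=1-p$; for $v_i\in V^*$, $d_i^*$ follows the binomial distribution with parameters $d_i$ and $1-p$ regarding the privacy labels. *)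

(* Defs.v *)
From mathcomp Require Import all_boot all_order all_algebra.
Set Implicit Arguments.
Unset Strict Implicit.
Unset Printing Implicit Defensive.
Import Order.TTheory GRing.Theory Num.Theory.
Local Open Scope ring_scope.

Definition simple_connected_graph (V : finType) (e : rel V) : Prop :=
  [/\ symmetric e, irreflexive e & forall u v, connect e u v].

Definition degree (V : finType) (e : rel V) (v : V) : nat :=
  #|[set u | e v u]|.

(* A labelling is encoded by its set S of public nodes. *)

Definition induced (V : finType) (e : rel V) (S : {set V}) : rel V :=
  [rel u v | [&& u \in S, v \in S & e u v]].

(* The empty labelling has no public-cluster. *)
Definition public_clusters (V : finType) (e : rel V) (S : {set V}) :
    {set {set V}} :=
  equivalence_partition (connect (induced e S)) S.

Definition largest_public_cluster (V : finType) (e : rel V)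
    (S C : {set V}) : bool :=
  (C \in public_clusters e S) &&
  [forall D in public_clusters e S, #|D| <= #|C|]%N.

Definition public_degree (V : finType) (e : rel V) (C : {set V}) (v : V) :
    nat :=
  #|[set u in C | induced e C v u]|.

(* Law of the labels: nodes are independently private with probability p. *)
Definition label_prob (R : realFieldType) (V : finType) (p : R)
    (S : {set V}) : R :=
  \prod_(v : V) (if v \in S then 1 - p else p).

Definition Epri (R : realFieldType) (V : finType) (p : R)
    (X : {set V} -> R) : R :=
  \sum_(S : {set V}) label_prob p S * X S.

Definition Prpri (R : realFieldType) (V : finType) (p : R)
    (A : pred {set V}) : R :=
  Epri p (fun S => (A S)%:R).

Definition all_public_in_largest (V : finType) (e : rel V) (S : {set V}) :
    Prop :=
  exists2 C, largest_public_cluster e S C & S \subset C.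

(* [Vs S] is V^* for the labelling S; it is a function because several
   clusters may have maximal size.  V^* is forced to be a largest public-cluster
   only when one cluster contains every public node.  With independent labels
   and 0 < p < 1, requiring this for every S together with
   [all_public_in_cluster] below would restrict G to complete graphs, whereas
   the condition is meant as an idealisation in which, for an arbitrary G,
   Pr[v \in V^*] = 1 - p and d^*_v is binomial with parameters d_v, 1 - p. *)
Definition public_cluster_choice (V : finType) (e : rel V)
    (Vs : {set V} -> {set V}) : Prop :=
  forall S, Vs S \subset S /\
    (all_public_in_largest e S -> largest_public_cluster e S (Vs S)).

Definition all_public_in_cluster (R : realFieldType) (V : finType) (p : R)
    (Vs : {set V} -> {set V}) : Prop :=
  Prpri p (fun S => S \subset Vs S) = 1.

Lemma public_clusters_sub (V : finType) (e : rel V) (S C : {set V}) :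
  C \in public_clusters e S -> C \subset S.
Proof.
by case/imsetP=> x _ ->; apply/subsetP=> y; rewrite inE => /andP[].
Qed.

Lemma all_public_in_largestE (V : finType) (e : rel V) (S : {set V}) :
  all_public_in_largest e S <-> largest_public_cluster e S S.
Proof.
split=> [[C lC sSC]|lS]; last by exists S.
suff E : S = C by rewrite {2}E.
apply/eqP; rewrite eqEsubset sSC /=.
by case/andP: lC => /public_clusters_sub.
Qed.

Lemma label_prob_sum (R : realFieldType) (V : finType) (p : R) :
  \sum_(S : {set V}) label_prob p S = 1.
Proof.
transitivity (\prod_(v : V) ((1 - p) + p)).
  by rewrite bigA_distr; apply: eq_big.
by rewrite big1 // => v _; rewrite subrK.
Qed.

(* The two assumptions on [Vs] are satisfiable for every graph and every p. *)
Lemma public_cluster_choice_id (V : finType) (e : rel V) :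
  public_cluster_choice e id.
Proof. by move=> S; split=> // /all_public_in_largestE. Qed.

Lemma all_public_in_cluster_id (R : realFieldType) (V : finType) (p : R) :
  all_public_in_cluster (V := V) p id.
Proof.
rewrite /all_public_in_cluster /Prpri /Epri -[RHS](label_prob_sum V p).
by apply: eq_bigr => S _; rewrite subxx mulr1.
Qed.

(* Main.v *)
(** The cluster V^* is almost surely the whole set S of public nodes, so every
    expectation reduces to Pr[A \subset S] = (1 - p)^#|A|.  Writing q = 1 - p,
    D1 = \sum_v d_v and D2 = \sum_v d_v^2, the three expectations are
    E[n^*] = q n, E[\sum_v d^*_v d_v] = q^2 D2 and
    E[\sum_v d^*_v d^*_v] = q^2 (p D1 + q D2).  Since 0 <= D1 <= D2, the
    estimator q n D2 / (p D1 + q D2) lies between q n and n. *)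
Require Import Defs.
From mathcomp Require Import all_boot all_order all_algebra.
From mathcomp Require Import ring lra.
Import Order.TTheory GRing.Theory Num.Theory.
Local Open Scope ring_scope.

Section Expectation.
#[local] Set Implicit Arguments.
#[local] Unset Strict Implicit.
Variables (R : realFieldType) (V : finType) (p : R).

Lemma eq_Epri (X Y : {set V} -> R) : X =1 Y -> Epri p X = Epri p Y.
Proof. by move=> XY; apply: eq_bigr => S _; rewrite XY. Qed.

Lemma Epri_sum (I : finType) (P : pred I) (X : I -> {set V} -> R) :
  Epri p (fun S => \sum_(i | P i) X i S) = \sum_(i | P i) Epri p (X i).
Proof.
by rewrite /Epri exchange_big; apply: eq_bigr => S _; rewrite mulr_sumr.
Qed.

Lemma Epri_mulr (X : {set V} -> R) (c : R) :
  Epri p (fun S => X S * c) = Epri p X * c.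
Proof. by rewrite /Epri mulr_suml; apply: eq_bigr => S _; rewrite mulrA. Qed.

(** Replacing the private weight [p] by 0 on [A] annihilates exactly the labellings that make some
    node of [A] private, so distributivity turns the probability into a product over nodes. *)
Lemma Prpri_superset (A : {set V}) :
  Prpri p (fun S => A \subset S) = (1 - p) ^+ #|A|.
Proof.
transitivity (\prod_(v : V) ((1 - p) + (if v \in A then 0 else p))).
  rewrite bigA_distr; apply: eq_big => // S _.
  have [AS|/subsetPn[v vA vS]] := boolP (A \subset S).
    rewrite mulr1; apply: eq_bigr => v _; case: ifP => // /negP vS.
    by case: ifP => // /(subsetP AS).
  by rewrite mulr0 (bigD1 v) //= (negPf vS) vA mul0r.
(* Nodes outside [A] contribute the factor [(1 - p) + p = 1]. *)
rewrite (bigID (mem A)) /= [X in _ * X]big1 ?mulr1 => [|v /negPf->].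
  rewrite (eq_bigr (fun=> 1 - p)) ?prodr_const // => v ->.
  by rewrite addr0.
by rewrite subrK.
Qed.

Lemma label_prob_ge0 (S : {set V}) : 0 <= p <= 1 -> 0 <= label_prob p S.
Proof.
case/andP=> p0 p1; apply: prodr_ge0 => v _.
by case: ifP => // _; rewrite subr_ge0.
Qed.

(** The complement of [A] has probability 0, and a sum of nonnegative terms vanishes only if every
    term does. *)
Lemma Prpri1_as (A : pred {set V}) (S : {set V}) :
  0 <= p <= 1 -> Prpri p A = 1 -> label_prob p S != 0 -> A S.
Proof.
move=> hp PA; apply: contraNT => nAS.
have: \sum_(T : {set V}) label_prob p T * (1 - (A T)%:R) = 0.
  transitivity (\sum_(T : {set V}) (label_prob p T - label_prob p T * (A T)%:R)).
    by apply: eq_bigr => T _; rewrite mulrBr mulr1.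
  by rewrite sumrB label_prob_sum -[X in _ - X]/(Prpri p A) PA subrr.
move/eqP; rewrite psumr_eq0 => [/allP/(_ S (mem_index_enum S))|T _].
  by rewrite (negPf nAS) subr0 mulr1.
by rewrite mulr_ge0 ?label_prob_ge0 // subr_ge0 lern1 leq_b1.
Qed.

Lemma Epri_cluster (e : rel V) (Vs : {set V} -> {set V}) (X : {set V} -> R) :
  0 <= p <= 1 -> public_cluster_choice e Vs -> all_public_in_cluster p Vs ->
  Epri p (fun S => X (Vs S)) = Epri p X.
Proof.
move=> hp hVs hcond; apply: eq_bigr => S _.
have [->|pS] := eqVneq (label_prob p S) 0; first by rewrite !mul0r.
suff -> : Vs S = S by [].
by apply/eqP; rewrite eqEsubset (hVs S).1 (Prpri1_as hp hcond pS).
Qed.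

Lemma Epri_card : Epri p (fun S : {set V} => #|S|%:R) = (1 - p) * #|V|%:R.
Proof.
transitivity (Epri p (fun S : {set V} => \sum_(v : V) ([set v] \subset S)%:R)).
  apply: eq_Epri => S; rewrite -sum1_card natr_sum big_mkcond.
  by apply: eq_bigr => v _; rewrite sub1set; case: (v \in S).
rewrite Epri_sum (eq_bigr (fun=> 1 - p)) => [|v _].
  by rewrite sumr_const mulr_natr.
by rewrite -[LHS]/(Prpri p _) Prpri_superset cards1 expr1.
Qed.

Section Graph.
Variable e : rel V.

(** The form as a sum of indicators makes linearity of expectation applicable. *)
Lemma public_degreeE (S : {set V}) (v : V) : v \in S ->
  (public_degree e S v)%:R = \sum_(u | e v u) (u \in S)%:R :> R.
Proof.
move=> vS; rewrite /public_degree cardsE -sum1_card natr_sum.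
rewrite [RHS](eq_bigr (fun u => if u \in S then 1 else 0)); last first.
  by move=> u _; case: (u \in S).
rewrite -big_mkcondr; apply: eq_bigl => u.
by rewrite unfold_in /induced /= vS; case: (u \in S); rewrite ?andbF ?andbT.
Qed.

Lemma degreeE (v : V) (c : R) : \sum_(u | e v u) c = c * (degree e v)%:R.
Proof. by rewrite /degree cardsE sumr_const mulr_natr. Qed.

Hypothesis e_irr : irreflexive e.

(** Each ordered pair of adjacent nodes, distinct by irreflexivity, is public with probability
    [(1 - p) ^+ 2]; a node [v] starts [degree e v] such pairs, each weighted by [degree e v]. *)
Lemma Epri_public_degree_degree :
  Epri p (fun S => \sum_(v in S) (public_degree e S v)%:R * (degree e v)%:R)
  = (1 - p) ^+ 2 * \sum_v (degree e v)%:R ^+ 2.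
Proof.
transitivity (Epri p (fun S => \sum_v \sum_(u | e v u)
   ([set v; u] \subset S)%:R * (degree e v)%:R)).
  apply: eq_Epri => S; rewrite big_mkcond; apply: eq_bigr => v _.
  rewrite -mulr_suml; under [X in _ = X * _]eq_bigr do rewrite subUset !sub1set.
  by case: ifP => [/public_degreeE->|_] //; rewrite big1 ?mul0r.
rewrite Epri_sum mulr_sumr; apply: eq_bigr => v _; rewrite Epri_sum.
rewrite [_%:R ^+ 2]expr2 mulrA -degreeE.
apply: eq_bigr => u evu; rewrite Epri_mulr -[X in X * _]/(Prpri p _).
rewrite Prpri_superset cards2.
by case: eqVneq evu => [->|//]; rewrite e_irr.
Qed.

(** The square counts ordered pairs [(u, w)] of public neighbours of a public [v]. The set of the
    three nodes has size 2 if [u = w] and 3 otherwise, so with [q = 1 - p] and [d] the degree, [v]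
    contributes [q^2 d + q^3 (d^2 - d) = q^2 (p d + q d^2)]. *)
Lemma Epri_public_degree_sqr :
  Epri p (fun S => \sum_(v in S) (public_degree e S v)%:R ^+ 2)
  = (1 - p) ^+ 2 * (p * (\sum_v (degree e v)%:R)
                    + (1 - p) * \sum_v (degree e v)%:R ^+ 2).
Proof.
transitivity (Epri p (fun S => \sum_v \sum_(u | e v u) \sum_(w | e v w)
   ([set v; u; w] \subset S)%:R)).
  apply: eq_Epri => S; rewrite big_mkcond; apply: eq_bigr => v _.
  under eq_bigr do under eq_bigr do rewrite !subUset !sub1set -andbA.
  case: ifP => [/public_degreeE->|_] /=; last by rewrite big1 // => u _; rewrite big1.
  rewrite expr2 mulr_suml; apply: eq_bigr => u _; rewrite mulr_sumr.
  by apply: eq_bigr => w _; rewrite -natrM mulnb.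
rewrite Epri_sum !mulr_sumr -big_split mulr_sumr; apply: eq_bigr => v _ /=.
transitivity (\sum_(u | e v u)
   ((1 - p) ^+ 3 * (degree e v)%:R + ((1 - p) ^+ 2 - (1 - p) ^+ 3))); last first.
  by rewrite degreeE; ring.
rewrite Epri_sum; apply: eq_bigr => u evu; rewrite Epri_sum.
have vu : v != u by apply: contraTneq evu => ->; rewrite e_irr.
(* Every [w] is charged the generic probability [(1 - p) ^+ 3]; the indicator corrects the single
   diagonal term [w = u]. *)
transitivity (\sum_(w | e v w)
   ((1 - p) ^+ 3 + (w == u)%:R * ((1 - p) ^+ 2 - (1 - p) ^+ 3))).
  apply: eq_bigr => w evw; rewrite -[LHS]/(Prpri p _) Prpri_superset.
  have vw : v != w by apply: contraTneq evw => ->; rewrite e_irr.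
  rewrite setUC cardsU1 cards2 !inE vu [w == v]eq_sym (negPf vw) /=.
  by case: eqP => _ /=; ring.
rewrite big_split /= degreeE -mulr_suml (bigD1 u) //= eqxx big1 ?addr0 ?mul1r //.
by move=> w /andP[_ /negPf->].
Qed.

End Graph.
End Expectation.

(** A path between two distinct nodes has a first edge. This makes the degree sum, and hence the
    denominator for [p < 1], positive. *)
Lemma connected_degree_gt0 (V : finType) (e : rel V) :
  simple_connected_graph e -> (1 < #|V|)%N -> exists v, (0 < degree e v)%N.
Proof.
case=> _ _ conn /card_gt1P[x [y [_ _ xy]]]; exists x.
case/connectP: (conn x y) => [[|z s] /= es yE]; first by rewrite yE eqxx in xy.
by case/andP: es => exz _; apply/card_gt0P; exists z; rewrite inE.
Qed.

Theorem corollary4p7 (R : realFieldType) (V : finType) (e : rel V) (p : R)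
    (Vs : {set V} -> {set V})
    (hG : simple_connected_graph e)
    (hn : (1 < #|V|)%N)
    (hp : 0 <= p <= 1)
    (hVs : public_cluster_choice e Vs)
    (hcond : all_public_in_cluster p Vs) :
  let n : R := #|V|%:R in
  let Enstar : R := Epri p (fun S => #|Vs S|%:R) in
  let Edd : R := Epri p (fun S =>
    \sum_(v in Vs S) (public_degree e (Vs S) v)%:R * (degree e v)%:R) in
  let Edstar2 : R := Epri p (fun S =>
    \sum_(v in Vs S) (public_degree e (Vs S) v)%:R ^+ 2) in
  `|n - Enstar * Edd / Edstar2| <= `|n - Enstar|.
Proof.
have e_irr : irreflexive e by case: hG.
cbv zeta.
rewrite (Epri_cluster (fun S => #|S|%:R) hp hVs hcond) Epri_card.
rewrite (Epri_cluster (fun S =>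
  \sum_(v in S) (public_degree e S v)%:R * (degree e v)%:R) hp hVs hcond).
rewrite (Epri_cluster (fun S =>
  \sum_(v in S) (public_degree e S v)%:R ^+ 2) hp hVs hcond).
rewrite Epri_public_degree_degree // Epri_public_degree_sqr //.
set n : R := #|V|%:R.
set D1 := \sum_v (degree e v)%:R; set D2 := \sum_v (degree e v)%:R ^+ 2.
have n0 : 0 <= n by exact: ler0n.
have D1_gt0 : 0 < D1.
  have [v dv] := connected_degree_gt0 _ _ hG hn.
  by rewrite /D1 (bigD1 v) //= ltr_pwDl ?ltr0n // sumr_ge0.
have D12 : D1 <= D2.
  apply: ler_sum => v _; rewrite -natrX ler_nat.
  by case: (degree e v) => // d; rewrite leq_pmulr.
have /andP[p0 p1] := hp; set q := 1 - p.
(* For [p = 1] numerator and denominator are both 0; the quotient is then 0, equal to [E[n^*]], and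
   the two sides agree. *)
have [q_eq0|q_neq0] := eqVneq q 0; first by rewrite q_eq0 !mul0r.
have q_gt0 : 0 < q by rewrite lt_def q_neq0 subr_ge0.
set M := p * D1 + q * D2.
have M_gt0 : 0 < M.
  rewrite ltr_wpDl //; first by rewrite mulr_ge0 // ltW.
  by rewrite mulr_gt0 // (lt_le_trans D1_gt0).
have -> : q * n * (q ^+ 2 * D2) / (q ^+ 2 * M) = q * n * D2 / M.
  by field; rewrite q_neq0 gt_eqF.
(* This amounts to [q * D2 <= M], which holds as [p * D1] is nonnegative. *)
have le_n : q * n * D2 / M <= n.
  rewrite ler_pdivrMr // mulrAC [q * D2 * n]mulrC ler_wpM2l //.
  by rewrite lerDr mulr_ge0 // ltW.
(* [M] is a convex combination of [D1] and [D2], so [D1 <= D2] gives [M <= D2]. *)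
have ge_qn : q * n <= q * n * D2 / M.
  rewrite ler_pdivlMr // ler_wpM2l ?mulr_ge0 //; first exact: ltW.
  have pD12 : p * D1 <= p * D2 by rewrite ler_wpM2l.
  by rewrite /M /q; lra.
by rewrite !ger0_norm ?lerB ?subr_ge0 // (le_trans ge_qn).
Qed.
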